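(* Let $G$ be a finite simple connected graph with normalized Laplacian $\mathcal{L}$ and Kemeny's constant $\mathcal{K}$, and let $\{x,y\}$ be a pair of distinct vertices of $G$ (an edge or a non-edge). Then the edge derivative of Kemeny's constant is bounded by $$\sum_{\lambda\neq 0}\left(\frac{-2}{\lambda^2}\right)+\mathcal{K} \;\le\; \frac{d\mathcal{K}}{d\{x,y\}} \;\le\; \mathcal{K},$$ where the sum is over the nonzero eigenvalues $\lambda$ of $\mathcal{L}$, counted with multiplicity.
   Context: For a finite simple connected graph $G$ with at least two vertices, $A$ is the adjacency matrix, $d_x$ is the degree of the vertex $x$, $D$ is the diagonal matrix of degrees (invertible), and the normalized Laplacian is $\mathcal{L} = I - D^{-1/2} A D^{-1/2}$. Edge derivative of an eigenvalue: let $\lambda$ be an eigenvalue of $\mathcal{L}$ of multiplicity $k$, let $\mathbf{v}_1,\dots,\mathbf{v}_k$ be an orthonormal basis of the $\lambda$-eigenspace, and write $\mathbf{v}_{i,x}$ for the entry of $\mathbf{v}_i$ at the vertex $x$. For a pair $\{x,y\}$ of distinct vertices (adjacent or not), $$\frac{d\lambda}{d\{x,y\}} = \frac1k\sum_{i=1}^k\left[(1-\lambda)\left(\frac{\mathbf{v}_{i,x}^2}{d_x}+\frac{\mathbf{v}_{i,y}^2}{d_y}\right)-2\,\frac{\mathbf{v}_{i,x}\mathbf{v}_{i,y}}{\sqrt{d_xd_y}}\right].$$ This value does not depend on the choice of the orthonormal basis. Kemeny's constant of $G$ is $\mathcal{K}=\mathcal{K}(G)=\sum_{\lambda\ne 0}\frac1\lambda$,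 the sum being over the nonzero eigenvalues of $\mathcal{L}$ counted with multiplicity, and its edge derivative is $$\frac{d\mathcal{K}}{d\{x,y\}}=\sum_{\lambda\neq 0}-\frac{1}{\lambda^2}\,\frac{d\lambda}{d\{x,y\}},$$ again over the nonzero eigenvalues counted with multiplicity. *)

(* Defs.v *)
From mathcomp Require Import all_boot all_order all_algebra.
From mathcomp Require Import polyrcf.
Set Implicit Arguments.
Unset Strict Implicit.
Unset Printing Implicit Defensive.
Import Order.TTheory GRing.Theory Num.Theory.
Local Open Scope ring_scope.

Definition simple_graph (T : finType) (e : rel T) : Prop :=
  symmetric e /\ irreflexive e.

Definition connected_graph (T : finType) (e : rel T) : Prop :=
  forall x y : T, connect e x y.

Definition degree (T : finType) (e : rel T) (x : T) : nat := #|[set y | e x y]|.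

(* Matrices are indexed by 'I_#|T|; the vertex x has index enum_rank x. *)
Definition adjacency_mx (R : rcfType) (T : finType) (e : rel T) : 'M[R]_#|T| :=
  \matrix_(i, j) (e (enum_val i) (enum_val j))%:R.

Definition invsqrt_degree_mx (R : rcfType) (T : finType) (e : rel T) :
    'M[R]_#|T| :=
  diag_mx (\row_i (Num.sqrt (degree e (enum_val i))%:R)^-1).

Definition normalized_laplacian (R : rcfType) (T : finType) (e : rel T) :
    'M[R]_#|T| :=
  1%:M - invsqrt_degree_mx R e *m adjacency_mx R e *m invsqrt_degree_mx R e.

(* Dimension of the eigenspace.  [eigenspace] is made of row vectors v with
   v *m M = a *: v, which is the usual eigenspace when M is symmetric. *)
Definition multiplicity (R : rcfType) (n : nat) (M : 'M[R]_n) (a : R) : nat :=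
  \rank (eigenspace M a).

(* Each eigenvalue in R is listed as many times as its multiplicity; [rootsR]
   lists the roots in R of a nonzero polynomial without repetition.  For a
   symmetric M this is the whole spectrum. *)
Definition spectrum (R : rcfType) (n : nat) (M : 'M[R]_n) : seq R :=
  flatten [seq nseq (multiplicity M a) a | a <- rootsR (char_poly M)].

Definition orthonormal_eigenbasis (R : rcfType) (n : nat) (M : 'M[R]_n) (a : R)
    (V : 'M[R]_(multiplicity M a, n)) : Prop :=
  (V :=: eigenspace M a)%MS /\ V *m V^T = 1%:M.

(* The rows of V are the vectors v_1, ..., v_k. *)
Definition edge_derivative (R : rcfType) (T : finType) (e : rel T) (a : R)
    (V : 'M[R]_(multiplicity (normalized_laplacian R e) a, #|T|)) (x y : T) : R :=
  (multiplicity (normalized_laplacian R e) a)%:R^-1 *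
  \sum_i ((1 - a) * (V i (enum_rank x) ^+ 2 / (degree e x)%:R +
                     V i (enum_rank y) ^+ 2 / (degree e y)%:R) -
          2 * (V i (enum_rank x) * V i (enum_rank y) /
               Num.sqrt ((degree e x)%:R * (degree e y)%:R))).

Definition kemeny (R : rcfType) (T : finType) (e : rel T) : R :=
  \sum_(a <- spectrum (normalized_laplacian R e) | a != 0) a^-1.

(* V chooses an orthonormal basis of each eigenspace. *)
Definition kemeny_edge_derivative (R : rcfType) (T : finType) (e : rel T)
    (V : forall a : R, 'M[R]_(multiplicity (normalized_laplacian R e) a, #|T|))
    (x y : T) : R :=
  \sum_(a <- spectrum (normalized_laplacian R e) | a != 0)
    - (a ^+ 2)^-1 * edge_derivative (V a) x y.

(* Main.v *)
Require Import Defs.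
From mathcomp Require Import all_boot all_order all_algebra.
From mathcomp Require Import polyrcf ring lra.
Import Order.TTheory GRing.Theory Num.Theory.
Local Open Scope ring_scope.

(** Put p = v_x / sqrt d_x and q = v_y / sqrt d_y for a unit eigenvector v of
    eigenvalue a.  Its contribution to the edge derivative of a is
    (p - q)^2 - a (p^2 + q^2).  Since p^2 + q^2 <= |v|^2 = 1 and 0 <= a <= 2, it
    lies between -a and 2 - a, and so does the average over an orthonormal basis.
    Multiplying by - 1 / a^2 gives the bounds eigenvalue by eigenvalue.

    The bounds on a hold because (1 - a) |v|^2 is the adjacency form of the
    vector with entries v_z / sqrt d_z, which AM-GM bounds by |v|^2. *)

Lemma mem_spectrum_eigenvalue (R : rcfType) (n : nat) (M : 'M[R]_n) (a : R) :
  a \in spectrum M -> eigenvalue M a.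
Proof.
case/flattenP=> s /mapP[b b_root ->]; rewrite mem_nseq => /andP[_ /eqP->].
by rewrite eigenvalue_root_char; exact: root_roots b_root.
Qed.

(** A path from [x] to a second vertex starts with an edge at [x]. *)
Lemma connected_degree_gt0 {T : finType} (e : rel T) (x : T) :
  connected_graph e -> (1 < #|T|)%N -> (0 < degree e x)%N.
Proof.
move=> conn T_gt1.
have [y yNx] : exists y, y != x.
  apply/existsP; apply: contraLR T_gt1; rewrite negb_exists -leqNgt.
  move=> /forallP h.
  rewrite -(card1 x); apply: subset_leq_card.
  by apply/subsetP=> z _; have := h z; rewrite negbK.
have /connectP[[|z p] /=] := conn x y.
  by move=> _ yx; rewrite yx eqxx in yNx.
by case/andP=> exz _ _; apply/card_gt0P; exists z; rewrite inE.
Qed.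

Lemma mean_bounds (R : realFieldType) (k : nat) (F : 'I_k -> R) (l h : R) :
  (0 < k)%N -> (forall i, l <= F i <= h) -> l <= k%:R^-1 * \sum_i F i <= h.
Proof.
move=> k_gt0 lFh; have k_gt0' : 0 < k%:R :> R by rewrite ltr0n.
rewrite mulrC ler_pdivlMr // ler_pdivrMr // !mulr_natr.
have sum_const (c : R) : c *+ k = \sum_(i < k) c by rewrite sumr_const card_ord.
by rewrite !sum_const; apply/andP; split; apply: ler_sum => i _;
  have /andP[] := lFh i.
Qed.

Lemma unit_row_edge_term_bounds (R : rcfType) (n : nat) (u : 'rV[R]_n) (a : R)
    (i j : 'I_n) (c d : nat) :
  u *m u^T = 1%:M -> i != j -> (0 < c)%N -> (0 < d)%N -> 0 <= a <= 2 ->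
  - a <= (1 - a) * (u 0 i ^+ 2 / c%:R + u 0 j ^+ 2 / d%:R)
         - 2 * (u 0 i * u 0 j / Num.sqrt (c%:R * d%:R)) <= 2 - a.
Proof.
move=> /matrixP/(_ 0 0) uu1 ij c_gt0 d_gt0 /andP[a_ge0 a_le2].
have {uu1} uij_le1 : u 0 i ^+ 2 + u 0 j ^+ 2 <= 1.
  move: uu1; rewrite !mxE eqxx mulr1n => <-.
  rewrite (bigD1 i) // (bigD1 j) 1?eq_sym //= !mxE !expr2.
  rewrite addrA lerDl sumr_ge0 // => k _.
  by rewrite mxE -expr2 sqr_ge0.
(* A positive degree is at least 1, so dividing by it cannot increase a square. *)
have sqr_div (w : R) (m : nat) : (0 < m)%N ->
    w ^+ 2 / m%:R = (w / Num.sqrt m%:R) ^+ 2 /\ w ^+ 2 / m%:R <= w ^+ 2.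
  move=> m_gt0; split; first by rewrite exprMn exprVn sqr_sqrtr ?ler0n.
  by rewrite ler_pdivrMr ?ltr0n // ler_peMr ?sqr_ge0 // ler1n.
have [ui2 ui_le] := sqr_div (u 0 i) c c_gt0.
have [uj2 uj_le] := sqr_div (u 0 j) d d_gt0.
rewrite sqrtrM ?ler0n // invfM mulrACA.
move: ui_le uj_le; rewrite ui2 uj2.
set p := _ / _; set q := _ / _ => p_le q_le.
have pq_le1 : p ^+ 2 + q ^+ 2 <= 1 by lra.
(* With S = p^2 + q^2 and E = (1 - a) S - 2 p q, the two bounds come from E + a = (p - q)^2 + a (1 -
   S) and 2 - a - E = (p + q)^2 + (2 - a) (1 - S). *)
have := sqr_ge0 (p - q); have := sqr_ge0 (p + q).
have pq_ge0 : 0 <= 1 - (p ^+ 2 + q ^+ 2) by rewrite subr_ge0.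
have := mulr_ge0 a_ge0 pq_ge0.
have : 0 <= (2 - a) * (1 - (p ^+ 2 + q ^+ 2)) by rewrite mulr_ge0 // subr_ge0.
by move=> *; apply/andP; split; nra.
Qed.

Section Laplacian.
Variables (R : rcfType) (T : finType) (e : rel T).
Hypotheses (e_sym : symmetric e) (deg_gt0 : forall x, (0 < degree e x)%N).

Let s (i : 'I_#|T|) : R := (Num.sqrt (degree e (enum_val i))%:R)^-1.

Lemma mulmx_normalized_laplacian (v : 'rV[R]_#|T|) (j : 'I_#|T|) :
  (v *m normalized_laplacian R e) 0 j =
  v 0 j - \sum_i (e (enum_val i) (enum_val j))%:R * (v 0 i * s i) * s j.
Proof.
rewrite mulmxBr mulmx1 !mulmxA [LHS]mxE [X in _ + X]mxE; congr (_ - _).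
rewrite /invsqrt_degree_mx mul_mx_diag !mxE mulr_suml.
by apply: eq_bigr => i _; rewrite mul_mx_diag !mxE [_%:R * _]mulrC.
Qed.

Lemma sum_adjacency (i : 'I_#|T|) :
  \sum_(j < #|T|) (e (enum_val i) (enum_val j))%:R
  = (degree e (enum_val i))%:R :> R.
Proof.
rewrite -(big_enum_val (A := T) (fun z => (e (enum_val i) z)%:R)).
by rewrite -natr_sum /degree -sum1dep_card big_mkcond /=; congr _%:R;
  rewrite [RHS]big_mkcond; apply: eq_bigr => z _; case: (e _ z).
Qed.

(** Each square occurs once per neighbour of [i], and these copies cancel [s i ^+ 2], the inverse of
    the degree. *)
Lemma sum_adjacency_sqr (v : 'rV[R]_#|T|) :
  \sum_(i < #|T|) \sum_(j < #|T|)
    (e (enum_val i) (enum_val j))%:R * (v 0 i * s i) ^+ 2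
  = \sum_i v 0 i ^+ 2.
Proof.
apply: eq_bigr => i _; rewrite -mulr_suml sum_adjacency exprMn exprVn.
have d_gt0 : 0 < (degree e (enum_val i))%:R :> R by rewrite ltr0n.
by rewrite sqr_sqrtr ?ler0n // mulrC divfK // gt_eqF.
Qed.

(** On the eigenvector [v], D^(-1/2) A D^(-1/2) = I - L acts as 1 - a; pair the result with [v]. *)
Lemma quadratic_form_normalized_laplacian (v : 'rV[R]_#|T|) (a : R) :
  v *m normalized_laplacian R e = a *: v ->
  \sum_(i < #|T|) \sum_(j < #|T|) (e (enum_val i) (enum_val j))%:R *
     ((v 0 i * s i) * (v 0 j * s j))
  = (1 - a) * \sum_i v 0 i ^+ 2.
Proof.
move=> Lv; rewrite exchange_big mulr_sumr; apply: eq_bigr => j _ /=.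
have := mulmx_normalized_laplacian v j; rewrite Lv mxE => av.
have -> : (1 - a) * v 0 j ^+ 2 = v 0 j * (v 0 j - a * v 0 j) by ring.
rewrite av subKr mulr_sumr.
by apply: eq_bigr => i _; ring.
Qed.

Lemma normalized_laplacian_eigenvalue_bounds (a : R) :
  eigenvalue (normalized_laplacian R e) a -> 0 <= a <= 2.
Proof.
case/eigenvalueP=> v Lv v_neq0.
have norm_gt0 : 0 < \sum_i v 0 i ^+ 2.
  rewrite lt_neqAle eq_sym sumr_ge0 ?andbT; last by move=> i _; rewrite sqr_ge0.
  apply: contra_neq v_neq0 => /psumr_eq0P v0; apply/rowP=> i; rewrite mxE.
  by apply/eqP; rewrite -sqrf_eq0 v0 // => j _; rewrite sqr_ge0.
(* With w_i = v_i / sqrt d_i, the form is the sum of (w_i + c w_j)^2 over ordered adjacent pairs.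
   Taking c = 1 gives a <= 2, and c = -1 gives 0 <= a. *)
have signed_form (c : R) : c ^+ 2 = 1 ->
    0 <= (2 + 2 * c * (1 - a)) * \sum_i v 0 i ^+ 2.
  move=> c2.
  suff <- : \sum_(i < #|T|) \sum_(j < #|T|) (e (enum_val i) (enum_val j))%:R *
      (v 0 i * s i + c * (v 0 j * s j)) ^+ 2 =
      (2 + 2 * c * (1 - a)) * \sum_i v 0 i ^+ 2.
    by do 2![apply: sumr_ge0 => ? _]; rewrite mulr_ge0 ?ler0n ?sqr_ge0.
  transitivity (\sum_i v 0 i ^+ 2 + \sum_i v 0 i ^+ 2
      + 2 * c * ((1 - a) * \sum_i v 0 i ^+ 2)); last by ring.
  rewrite -(quadratic_form_normalized_laplacian _ _ Lv).
  (* One copy of |v|^2 supplies the squares w_i^2; the other, with its indices swapped, supplies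
     w_j^2 by symmetry of [e]. *)
  rewrite -{2}sum_adjacency_sqr [X in _ = _ + X + _]exchange_big.
  rewrite -sum_adjacency_sqr.
  rewrite mulr_sumr -!big_split; apply: eq_bigr => i _ /=.
  rewrite mulr_sumr -!big_split; apply: eq_bigr => j _ /=.
  by rewrite (e_sym (enum_val j)) sqrrD [(c * _) ^+ 2]exprMn c2; ring.
have := signed_form 1; have := signed_form (-1).
rewrite sqrrN expr1n !pmulr_lge0 // => /(_ erefl) ? /(_ erefl) ?.
by apply/andP; split; lra.
Qed.

Lemma edge_derivative_bounds (a : R)
    (V : 'M[R]_(multiplicity (normalized_laplacian R e) a, #|T|)) (x y : T) :
  x != y -> eigenvalue (normalized_laplacian R e) a ->
  orthonormal_eigenbasis V ->
  - a <= edge_derivative V x y <= 2 - a.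
Proof.
move=> xy a_eig [_ VV1]; apply: mean_bounds => [|l].
  (* The eigenspace of an eigenvalue is nonzero, so the average is over a nonempty family. *)
  by rewrite lt0n mxrank_eq0.
have := unit_row_edge_term_bounds _ _ (row l V) a (enum_rank x)
  (enum_rank y) (degree e x) (degree e y).
rewrite !mxE; apply; rewrite ?(inj_eq enum_rank_inj) //.
  apply/matrixP=> i j; rewrite !ord1; have /matrixP/(_ l l) := VV1.
  by rewrite !mxE !eqxx => <-; apply: eq_bigr => m _; rewrite !mxE.
exact: normalized_laplacian_eigenvalue_bounds.
Qed.

End Laplacian.

Theorem theorem3p3 (R : rcfType) (T : finType) (e : rel T)
    (V : forall a : R, 'M[R]_(multiplicity (normalized_laplacian R e) a, #|T|))
    (x y : T) :
  simple_graph e -> connected_graph e -> (1 < #|T|)%N ->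
  (forall a : R, eigenvalue (normalized_laplacian R e) a ->
     orthonormal_eigenbasis (V a)) ->
  x != y ->
  \sum_(a <- spectrum (normalized_laplacian R e) | a != 0) (- 2 / a ^+ 2)
    + kemeny R e <= kemeny_edge_derivative V x y /\
  kemeny_edge_derivative V x y <= kemeny R e.
Proof.
move=> [e_sym _] conn T_gt1 V_basis xy.
have deg_gt0 z : (0 < degree e z)%N by apply: connected_degree_gt0.
rewrite /kemeny /kemeny_edge_derivative -big_split /=.
(* Membership in the spectrum is kept in the sums because [V a] is known to be a basis only when [a]
   is an eigenvalue. *)
rewrite !(big_seq_cond (fun a => a != 0)).
split; apply: ler_sum => a /andP[/mem_spectrum_eigenvalue a_eig a_neq0].
all: have /andP[dge dle] :=
  edge_derivative_bounds _ _ _ e_sym deg_gt0 _ _ _ _ xy a_eig (V_basis a a_eig).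
all: have a2_gt0 : 0 < a ^+ 2 by rewrite exprn_even_gt0.
(* Over the common denominator a^2, the bounds on the derivative d of a read a - 2 <= - d <= a. *)
all: have -> : a^-1 = a / a ^+ 2 by rewrite expr2 invfM mulVKf.
  rewrite -mulrDl mulNr mulrC -mulrN ler_pM2l ?invr_gt0 //; lra.
rewrite mulNr mulrC -mulNr ler_pM2r ?invr_gt0 //; lra.
Qed.
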